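(* Let $X,Y\in\mathrm{Sym}^+(p)$. Let $((U,D),(V,\Lambda))$ be a minimal pair for $X$ and $Y$, and let $A=\log(VU')$, $L=\log(D^{-1}\Lambda)$. Then the scaling–rotation curve $\chi(t;U,D,A,L)$, $0\le t\le1$, is minimal.
   Context: A prime denotes transpose. $\mathrm{Sym}^+(p)$ is the set of real symmetric positive-definite $p\times p$ matrices; $\mathrm{SO}(p)$ the set of rotation matrices; $\mathfrak{so}(p)$ the real antisymmetric $p\times p$ matrices; $\mathrm{Diag}(p)$ the real diagonal matrices; $\mathrm{Diag}^+(p)$ the diagonal matrices with positive diagonal entries (in no particular order). For $R\in\mathrm{SO}(p)$, $\log(R)$ denotes an $A\in\mathfrak{so}(p)$ with $\exp(A)=R$ whose Frobenius norm is smallest among all such $A$ (any such choice if not unique); on $\mathrm{Diag}^+(p)$, $\log$ is the entrywise logarithm of the diagonal. Scaling–rotation curve: $\chi(t;U,D,A,L)=\exp(At)\,U\,D\exp(Lt)\,U'\exp(A't)$, for $U\in\mathrm{SO}(p)$, $D\in\mathrm{Diag}^+(p)$, $A\in\mathfrak{so}(p)$, $L\in\mathrm{Diag}(p)$. $M=\mathrm{SO}(p)\times\mathrm{Diag}^+(p)$ carries the Riemannian metric which, for tangent vectors $(A_1U,L_1D),(A_2U,L_2D)$ at $(U,D)$, is $\frac{k}{2}\mathrm{trace}(A_1A_2')+\mathrm{trace}(L_1L_2)$, with $k>0$ fixed. Its geodesics are $\gamma(t;U,D,A,L)=(\exp(At)U,\exp(Lt)D)$, and its geodesic distance is $d^2((U,D),(V,\Lambda))=\frac{k}{2}\|\log(VU')\|_F^2+\|\log(\Lambda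 D^{-1})\|_F^2$, with $\|\cdot\|_F$ the Frobenius norm. The eigen-composition map $c:M\to\mathrm{Sym}^+(p)$ is $c(U,D)=UDU'$, and $\mathcal{E}_X=c^{-1}(X)$. A geodesic segment from a point of $\mathcal{E}_X$ to a point of $\mathcal{E}_Y$ is a minimal geodesic for $\mathcal{E}_X$ and $\mathcal{E}_Y$ if its length equals $\inf\{d((U,D),(V,\Lambda)):(U,D)\in\mathcal{E}_X,(V,\Lambda)\in\mathcal{E}_Y\}$. A pair $((U,D),(V,\Lambda))\in\mathcal{E}_X\times\mathcal{E}_Y$ is a minimal pair if $(U,D)$ and $(V,\Lambda)$ are connected by a minimal geodesic. A scaling–rotation curve $\chi:[0,1]\to\mathrm{Sym}^+(p)$ with $\chi(0)=X$, $\chi(1)=Y$ is called minimal if $\chi=c\circ\gamma$ for some minimal geodesic segment $\gamma$ connecting $\mathcal{E}_X$ and $\mathcal{E}_Y$. *)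

(* Defs.v *)
From mathcomp Require Import all_boot all_order all_algebra.
From mathcomp Require Import all_classical all_reals all_analysis.

Set Implicit Arguments.
Unset Strict Implicit.
Unset Printing Implicit Defensive.

Import Order.TTheory GRing.Theory Num.Theory numFieldNormedType.Exports.
Local Open Scope classical_set_scope.
Local Open Scope ring_scope.

Section ScalingRotation.
Context {R : realType} {p : nat}.
Implicit Types (A B D L U V W X Y : 'M[R]_p) (k t : R).

Definition SymPos : set 'M[R]_p :=
  [set X | X^T = X /\ forall v : 'rV[R]_p, v != 0 -> 0 < (v *m X *m v^T) 0 0].

Definition SO : set 'M[R]_p := [set U | U *m U^T = 1%:M /\ \det U = 1].

Definition so : set 'M[R]_p := [set A | A^T = - A].

Definition Diag : set 'M[R]_p := [set D | is_diag_mx D].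

Definition DiagPos : set 'M[R]_p := [set D | is_diag_mx D /\ forall i, 0 < D i i].

Definition frobenius A : R := Num.sqrt (\sum_i \sum_j A i j ^+ 2).

Definition expm A : 'M[R]_p :=
  limn (series (fun n => (n`!%:R : R)^-1 *: (A ^+ n))).

(* The logarithm of a rotation need not be unique, so it is a relation. *)
Definition is_logSO U A : Prop :=
  [/\ so A, expm A = U &
      forall B, so B -> expm B = U -> frobenius A <= frobenius B].

(* An arbitrary choice of logarithm: the distance below only uses its
   Frobenius norm, which does not depend on the choice. *)
Definition logSO U : 'M[R]_p := xget 0 [set A | is_logSO U A].

Definition logDiag D : 'M[R]_p := diag_mx (\row_i ln (D i i)).

Definition sr_curve U D A L t : 'M[R]_p :=
  expm (t *: A) *m U *m D *m expm (t *: L) *m U^T *m expm (t *: A^T).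

Definition M : set ('M[R]_p * 'M[R]_p) := SO `*` DiagPos.

(* Tangent vectors of M at (U, D) are given by their ambient coordinates
   (W1, W2) = (A U, L D), so that A = W1 U^-1 and L = W2 D^-1. *)
Definition metric k (P Wa Wb : 'M[R]_p * 'M[R]_p) : R :=
  k / 2 * \tr ((Wa.1 *m invmx P.1) *m (Wb.1 *m invmx P.1)^T)
  + \tr ((Wa.2 *m invmx P.2) *m (Wb.2 *m invmx P.2)).

Definition geodesic U D A L t : 'M[R]_p * 'M[R]_p :=
  (expm (t *: A) *m U, expm (t *: L) *m D).

(* M is geodesically complete: a geodesic segment is the restriction to [0, 1]
   of a geodesic defined on the whole line. *)
Definition is_geodesic (gamma : R -> 'M[R]_p * 'M[R]_p) : Prop :=
  exists U D A L, [/\ SO U, DiagPos D, so A, Diag L &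
    forall t, gamma t = geodesic U D A L t].

Definition velocity (gamma : R -> 'M[R]_p * 'M[R]_p) t : 'M[R]_p * 'M[R]_p :=
  (derive1 (fun s => (gamma s).1) t, derive1 (fun s => (gamma s).2) t).

Definition curve_length k (gamma : R -> 'M[R]_p * 'M[R]_p) : R :=
  \int[lebesgue_measure]_(t in `[0, 1])
    Num.sqrt (metric k (gamma t) (velocity gamma t) (velocity gamma t)).

Definition geodesic_dist k (P Q : 'M[R]_p * 'M[R]_p) : R :=
  Num.sqrt (k / 2 * frobenius (logSO (Q.1 *m P.1^T)) ^+ 2
            + frobenius (logDiag (Q.2 *m invmx P.2)) ^+ 2).

Definition eigen_comp (P : 'M[R]_p * 'M[R]_p) : 'M[R]_p :=
  P.1 *m P.2 *m P.1^T.

Definition fiber X : set ('M[R]_p * 'M[R]_p) :=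
  [set P | M P /\ eigen_comp P = X].

Definition fiber_dist k X Y : R :=
  inf [set geodesic_dist k P Q | P in fiber X & Q in fiber Y].

Definition minimal_geodesic k X Y (gamma : R -> 'M[R]_p * 'M[R]_p) : Prop :=
  [/\ is_geodesic gamma, fiber X (gamma 0), fiber Y (gamma 1) &
      curve_length k gamma = fiber_dist k X Y].

Definition minimal_pair k X Y (P Q : 'M[R]_p * 'M[R]_p) : Prop :=
  [/\ fiber X P, fiber Y Q &
      exists gamma, [/\ minimal_geodesic k X Y gamma, gamma 0 = P & gamma 1 = Q]].

Definition is_sr_curve (chi : R -> 'M[R]_p) : Prop :=
  exists U D A L, [/\ SO U, DiagPos D, so A, Diag L &
    forall t, 0 <= t <= 1 -> chi t = sr_curve U D A L t].

Definition minimal_sr_curve k X Y (chi : R -> 'M[R]_p) : Prop :=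
  [/\ is_sr_curve chi, chi 0 = X, chi 1 = Y &
      exists2 gamma, minimal_geodesic k X Y gamma &
        forall t, 0 <= t <= 1 -> chi t = eigen_comp (gamma t)].

End ScalingRotation.

(* Main.v *)
(**
The segment t |-> (exp(tA) U, exp(tL) D) has constant speed, so its length is
sqrt (k/2 |A|^2 + |L|^2). The minimal geodesic witnessing the minimal pair also
runs from (U, D) to (V, Lam), so its generators (A', L') satisfy
exp A' = V U^T = exp A, whence |A| <= |A'|, and L' = L because exp is injective
on diagonal matrices. Hence the segment generated by (A, L) is at most as long
as a minimal geodesic. Conversely, its length is the distance between two
points of the fibers, so it is at least the infimum.
*)
Require Import Defs.
From mathcomp Require Import all_boot all_order all_algebra.
From mathcomp Require Import all_classical all_reals all_analysis.

Import Order.TTheory GRing.Theory Num.Theory numFieldNormedType.Exports.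
Local Open Scope classical_set_scope.
Local Open Scope ring_scope.

(** * Entrywise limits of matrix sequences *)

Section MatrixLimits.
Context {R : realType}.

Lemma mx_normr_entry_le {m n : nat} (M : 'M[R]_(m, n)) i j : `|M i j| <= `|M|.
Proof.
rewrite [leRHS]/Num.Def.normr/= mx_normrE.
exact: (le_bigmax _ (fun ij : 'I_m * 'I_n => `|M ij.1 ij.2|) (i, j)).
Qed.

Lemma cvg_mxP {m n : nat} (S : nat -> 'M[R]_(m, n)) (M : 'M[R]_(m, n)) :
  S @ \oo --> M <-> forall i j, (fun N => S N i j) @ \oo --> M i j.
Proof.
split=> [SM i j|SM].
  exact: (cvg_comp _ _ SM (@coord_continuous R m n i j M)).
apply/cvgrPdist_le => /= e e0; near=> N.
rewrite /Num.Def.normr/= mx_normrE (bigmax_le _ (ltW e0))//= => i _.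
rewrite !mxE/=.
(* There are finitely many entries, so one rank serves all of them. *)
move: i; near: N; apply: filter_forall => /= i.
exact: ((cvgrPdist_le _ _).1 (SM i.1 i.2)).
Unshelve. all: by end_near. Qed.

Lemma cvg_mulmxr {m n q : nat} {S : nat -> 'M[R]_(m, n)} {M : 'M[R]_(m, n)}
    (B : 'M[R]_(n, q)) :
  S @ \oo --> M -> (fun N => S N *m B) @ \oo --> M *m B.
Proof.
move=> /cvg_mxP SM; apply/cvg_mxP => i j; rewrite mxE.
under eq_fun do rewrite mxE.
apply: cvg_big => [|k _]; first exact: add_continuous.
apply: cvgMr_tmp; exact: SM.
Qed.

Lemma cvg_trmx {m n : nat} {S : nat -> 'M[R]_(m, n)} {M : 'M[R]_(m, n)} :
  S @ \oo --> M -> (fun N => (S N)^T) @ \oo --> M^T.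
Proof.
move=> /cvg_mxP SM; apply/cvg_mxP => i j; rewrite mxE.
by under eq_fun do rewrite mxE; exact: SM.
Qed.

Lemma cvg_mulmxl {m n q : nat} {S : nat -> 'M[R]_(m, n)} {M : 'M[R]_(m, n)}
    (B : 'M[R]_(q, m)) :
  S @ \oo --> M -> (fun N => B *m S N) @ \oo --> B *m M.
Proof.
move=> /cvg_trmx/(cvg_mulmxr B^T)/cvg_trmx; rewrite trmx_mul !trmxK.
by under eq_fun do rewrite trmx_mul !trmxK.
Qed.

End MatrixLimits.

(** * The matrix exponential: convergence, derivative, inverse, diagonal case *)

Section MatrixExponential.
Context {R : realType} {p : nat}.
Implicit Types A B : 'M[R]_p.

(** Power series coefficients in [t] of an entry of [expm (t *: A) *m B]. Carrying the factor [B]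
    keeps the family closed under differentiation, which replaces [B] by [A *m B]. *)
Definition expm_coeff A B (i j : 'I_p) (n : nat) : R :=
  n`!%:R^-1 * (A ^+ n *m B) i j.

Lemma exprS_mulmx A n : A ^+ n.+1 = A *m A ^+ n.
Proof. exact: exprS. Qed.

Lemma exprSr_mulmx A n : A ^+ n.+1 = A ^+ n *m A.
Proof. exact: exprSr. Qed.

(** The norm is the largest absolute entry; each product with [A] sums [p] terms, hence costs a
    factor [p%:R * |A|]. *)
Lemma normr_expr_mulmx_le A B i j n :
  `|(A ^+ n *m B) i j| <= `|B| * (p%:R * `|A|) ^+ n.
Proof.
elim: n i => [|n IH] i.
  by rewrite expr0 mulr1 [1]/(1%:M) mul1mx mx_normr_entry_le.
rewrite exprS_mulmx -mulmxA mxE (le_trans (ler_norm_sum _ _ _))//.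
rewrite (@le_trans _ _ (\sum_(k < p) `|A| * (`|B| * (p%:R * `|A|) ^+ n)))//.
  by apply: ler_sum => k _; rewrite normrM ler_pM ?mx_normr_entry_le.
by rewrite sumr_const card_ord exprS -[leLHS]mulr_natl mulrA mulrCA.
Qed.

(** Absolute convergence, by comparison with [|B|] times the real exponential series at
    [p%:R * |A| * |t|]. *)
Lemma is_cvg_expm_pseries A B i j t : cvgn (pseries (expm_coeff A B i j) t).
Proof.
pose v n := n`!%:R^-1 * (`|B| * (p%:R * `|A|) ^+ n) * `|t| ^+ n.
have v_ge0 n : 0 <= v n.
  by rewrite /v !mulr_ge0 ?invr_ge0 ?exprn_ge0 ?mulr_ge0.
apply: normed_cvg.
apply: (series_le_cvg (v_ := v)) => // [n|n|].
- exact: normr_ge0.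
- rewrite /= !normrM normrX normfV normr_nat /v.
  by rewrite ler_wpM2r ?exprn_ge0// ler_wpM2l ?invr_ge0// normr_expr_mulmx_le.
have -> : v = `|B| *: exp_coeff (p%:R * `|A| * `|t|).
  apply/funext => n; rewrite /v fctE /GRing.scale/= /exp_coeff/= !exprMn.
  by rewrite [RHS]mulrA [RHS]mulrC !mulrA.
apply: is_cvg_seriesZ; exact: is_cvg_series_exp_coeff.
Qed.

Lemma exprZ_mulmx A t n : (t *: A) ^+ n = t ^+ n *: A ^+ n.
Proof.
elim: n => [|n IH]; first by rewrite !expr0 scale1r.
by rewrite !exprS_mulmx IH -scalemxAl -scalemxAr scalerA -exprS.
Qed.

Lemma expm_series_entry A B t i j N :
  (series (fun n => (n`!%:R : R)^-1 *: ((t *: A) ^+ n)) N *m B) i j =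
  pseries (expm_coeff A B i j) t N.
Proof.
rewrite /pseries /series/= mulmx_suml summxE; apply: eq_bigr => n _.
by rewrite exprZ_mulmx -!scalemxAl scalerA !mxE /expm_coeff mxE mulrAC.
Qed.

Lemma cvg_expm A :
  series (fun n => (n`!%:R : R)^-1 *: (A ^+ n)) @ \oo --> expm A.
Proof.
rewrite /expm; apply/cvg_ex.
exists (\matrix_(i, j) limn (pseries (expm_coeff A 1%:M i j) 1)).
apply/cvg_mxP => i j; rewrite mxE.
under eq_fun do rewrite -[series _ _]mulmx1 -{1}[A]scale1r expm_series_entry.
exact: is_cvg_expm_pseries.
Qed.

Lemma expm_mulmx_entry A B t i j :
  (expm (t *: A) *m B) i j = limn (pseries (expm_coeff A B i j) t).
Proof.
apply/esym/cvg_lim => //.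
have /cvg_mxP/(_ i j) := cvg_mulmxr B (cvg_expm (t *: A)).
by under eq_fun do rewrite expm_series_entry.
Qed.

Lemma expm_trmx A : expm A^T = (expm A)^T.
Proof.
apply/esym/(cvg_unique _ _ (cvg_expm A^T)) => //.
have trX n : (A^T) ^+ n = (A ^+ n)^T.
  elim: n => [|n IH]; first by rewrite !expr0 trmx1.
  by rewrite exprS_mulmx IH -trmx_mul -exprSr_mulmx.
rewrite (_ : series _ = fun N => (series (fun n => n`!%:R^-1 *: A ^+ n) N)^T).
  exact: cvg_trmx (cvg_expm A).
apply/funext => N; rewrite /series/= raddf_sum/=.
by apply: eq_bigr => n _; rewrite linearZ /= trX.
Qed.

Lemma expm_commute A B : A *m B = B *m A -> expm A *m B = B *m expm A.
Proof.
move=> AB.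
apply: (cvg_unique _ (cvg_mulmxr B (cvg_expm A))) => //.
have XB n : A ^+ n *m B = B *m A ^+ n.
  elim: n => [|n IH]; first by rewrite !expr0 mul1mx mulmx1.
  by rewrite exprS_mulmx -mulmxA IH !mulmxA AB.
rewrite (_ : (fun N => _) =
    fun N => B *m series (fun n => n`!%:R^-1 *: A ^+ n) N).
  exact: cvg_mulmxl (cvg_expm A).
apply/funext => N; rewrite /series/= mulmx_suml mulmx_sumr.
by apply: eq_bigr => n _; rewrite -scalemxAr -XB scalemxAl.
Qed.

(** Termwise differentiation: the factor [n.+1] cancels against the factorial, and the spare [A] in
    the power is absorbed into [B]. *)
Lemma is_derive_expm_entry A B i j (t : R) :
  is_derive t (1 : R) (fun s => (expm (s *: A) *m B) i j)
    ((expm (t *: A) *m (A *m B)) i j).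
Proof.
have diffsE C : pseries_diffs (expm_coeff A C i j) = expm_coeff A (A *m C) i j.
  apply/funext => n; rewrite /pseries_diffs /expm_coeff exprSr_mulmx mulmxA.
  by rewrite factS natrM invfM mulrA mulVKf// pnatr_eq0.
under eq_fun do rewrite expm_mulmx_entry.
rewrite expm_mulmx_entry -diffsE.
(* The series converges everywhere, so any radius beyond [|t|] will do. *)
apply: (@pseries_snd_diffs _ _ (`|t| + 1)); rewrite ?diffsE;
  try exact: is_cvg_expm_pseries.
by rewrite [ltRHS]ger0_norm// addrC -subr_gt0 addrK.
Qed.

(** [A] is moved to the left, so that the right translation in [metric] can cancel the base point
    and leave [A]. *)
Lemma derive1_expm A B t :
  derive1 (fun s => expm (s *: A) *m B) t = A *m (expm (t *: A) *m B).
Proof.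
have dE : derivable (fun s : R => expm (s *: A) *m B) t 1.
  by apply/derivable_mxP => i j; apply: ex_derive; exact: is_derive_expm_entry.
rewrite derive1E derive_mx//; apply/matrixP => i j; rewrite mxE.
rewrite (@derive_val _ _ _ _ _ _ _ (is_derive_expm_entry A B i j t)).
rewrite mulmxA (mulmxA A).
by rewrite expm_commute// -scalemxAl -scalemxAr.
Qed.

Lemma expm0 : expm 0 = 1%:M :> 'M[R]_p.
Proof.
apply: (cvg_unique _ (cvg_expm 0)) => //; apply: cvg_near_cst.
(* The empty partial sum is 0; from rank 1 on, only the identity term survives. *)
exists 1%N => // -[//|n] _.
rewrite /series/= big_nat_recl// big1 ?addr0; last first.
  by move=> i _; rewrite exprS_mulmx mul0mx scaler0.
by rewrite expr0 fact0 invr1 scale1r.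
Qed.

(* The product is constant in t: its derivative is E A F - E A F = 0, and at
   t = 0 it is the identity. *)
Lemma expmV_scale A t : expm (t *: A) *m expm (t *: - A) = 1%:M.
Proof.
apply/matrixP => i j.
pose f (s : R) := (expm (s *: A) *m expm (s *: - A)) i j.
have -> : 1%:M i j = f 0 by rewrite /f !scale0r expm0 mulmx1.
apply: (is_derive_0_is_cst (f := f)) => s.
(* The trivial factor [1%:M] matches the form of the derivative lemma. *)
pose g (k : 'I_p) (s : R) := (expm (s *: A) *m 1%:M) i k.
pose h (k : 'I_p) (s : R) := (expm (s *: - A) *m 1%:M) k j.
have -> : f = \sum_(k < p) g k * h k.
  apply/funext => x; rewrite /f mxE fct_sumE; apply: eq_bigr => k _.
  by rewrite fctE /g /h !mulmx1.
have dgh k := is_deriveM (is_derive_expm_entry A 1%:M i k s)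
                (is_derive_expm_entry (- A) 1%:M k j s).
apply: (is_derive_eq (is_derive_sum dgh)).
set E := expm (s *: A); set F := expm (s *: - A).
have FA : F *m - A = - A *m F.
  by apply: expm_commute; rewrite -scalemxAl -scalemxAr.
transitivity ((E *m (F *m - A) + E *m A *m F) i j).
  rewrite mxE [X in _ = X + _]mxE [X in _ = _ + X]mxE -big_split /=.
  by apply: eq_bigr => k _; rewrite !mulmx1 /GRing.scale/= [X in _ + X]mulrC.
by rewrite FA mulNmx mulmxN mulmxA addNr mxE.
Qed.

Lemma expm_diag (d : 'rV[R]_p) :
  expm (diag_mx d) = diag_mx (\row_i expR (d 0 i)).
Proof.
have dX n : diag_mx d ^+ n = diag_mx (\row_i d 0 i ^+ n).
  elim: n => [|n IH].
    by rewrite expr0 [1]/(1%:M); apply/matrixP => i j; rewrite !mxE expr0.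
  rewrite exprS_mulmx IH mulmx_diag; congr diag_mx.
  by apply/rowP => i; rewrite !mxE exprS.
apply: (cvg_unique _ (cvg_expm _)) => //; apply/cvg_mxP => i j.
rewrite !mxE.
rewrite (_ : (fun N => _) = fun N => series (exp_coeff (d 0 i)) N *+ (i == j)).
  exact: cvgMn (is_cvg_series_exp_coeff _).
apply/funext => N; rewrite /series/= summxE -sumrMnl; apply: eq_bigr => n _.
by rewrite dX !mxE mulrnAr /exp_coeff/= mulrC.
Qed.

End MatrixExponential.

(** * Logarithm and exponential on diagonal matrices *)

Section DiagonalLog.
Context {R : realType} {p : nat}.
Implicit Types D E L : 'M[R]_p.

Lemma is_diag_mxE {D} : is_diag_mx D -> D = diag_mx (\row_i D i i).
Proof.
move=> /diag_mxP[d ->]; congr diag_mx.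
by apply/rowP => i; rewrite !mxE eqxx.
Qed.

Lemma is_diag_mxC {D E} : is_diag_mx D -> is_diag_mx E -> D *m E = E *m D.
Proof. by move=> /diag_mxP[d ->] /diag_mxP[e ->]; exact: diag_mxC. Qed.

Lemma DiagPos_mulmxV {D} :
  DiagPos D -> D *m diag_mx (\row_i (D i i)^-1) = 1%:M.
Proof.
move=> [/is_diag_mxE DE D_gt0]; rewrite [X in X *m _]DE mulmx_diag.
by apply/matrixP => i j; rewrite !mxE mulfV// gt_eqF.
Qed.

Lemma DiagPos_unit {D} : DiagPos D -> D \in unitmx.
Proof. by move=> /DiagPos_mulmxV/mulmx1_unit[]. Qed.

Lemma DiagPos_inv {D} : DiagPos D -> invmx D = diag_mx (\row_i (D i i)^-1).
Proof.
move=> Dpos; rewrite -[RHS]mul1mx -(mulVmx (DiagPos_unit Dpos)) -mulmxA.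
by rewrite DiagPos_mulmxV// mulmx1.
Qed.

Lemma expm_is_diag {L} : is_diag_mx L -> is_diag_mx (expm L).
Proof. by move=> /diag_mxP[l ->]; rewrite expm_diag diag_mx_is_diag. Qed.

Lemma expm_logDiag {D E} : DiagPos D -> DiagPos E ->
  expm (logDiag (invmx D *m E)) *m D = E.
Proof.
move=> Dpos [/is_diag_mxE EE E_gt0]; have [/is_diag_mxE DE D_gt0] := Dpos.
rewrite /logDiag expm_diag DiagPos_inv// [X in _ *m X = _]DE mulmx_diag.
rewrite [RHS]EE; congr diag_mx; apply/rowP => i.
rewrite mul_diag_mx !mxE lnK; first by rewrite mulrAC mulVf ?mul1r ?gt_eqF.
by rewrite posrE mulr_gt0// invr_gt0.
Qed.

Lemma logDiag_expm {L} : is_diag_mx L -> logDiag (expm L) = L.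
Proof.
move=> /diag_mxP[l ->]; rewrite expm_diag; congr diag_mx.
by apply/rowP => i; rewrite !mxE eqxx !mulr1n expRK.
Qed.

End DiagonalLog.

(** * Length of geodesic segments *)

Section Length.
Context {R : realType} {p : nat}.
Implicit Types A D L U : 'M[R]_p.

Lemma sqr_frobenius A : frobenius A ^+ 2 = \tr (A *m A^T).
Proof.
rewrite sqr_sqrtr; last by do 2![apply: sumr_ge0 => ? _]; exact: sqr_ge0.
apply: eq_bigr => i _; rewrite mxE; apply: eq_bigr => j _.
by rewrite mxE expr2.
Qed.

Lemma expm_unit A : expm A \in unitmx.
Proof. by rewrite -[A]scale1r; have /mulmx1_unit[] := expmV_scale A 1. Qed.

Lemma mulmx_SO_V {U} : SO U -> U^T *m U = 1%:M.
Proof. by move=> [/mulmx1C]. Qed.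

Lemma SO_unit {U} : SO U -> U \in unitmx.
Proof. by move=> [/mulmx1_unit[]]. Qed.

(** Translated back by the base point, the velocity is the constant pair [(A, L)], so the integrand
    is constant on an interval of length 1. *)
Lemma curve_length_geodesic k {U D} A {L} : U \in unitmx -> D \in unitmx ->
  is_diag_mx L ->
  curve_length k (geodesic U D A L) =
  Num.sqrt (k / 2 * frobenius A ^+ 2 + frobenius L ^+ 2).
Proof.
move=> Uunit Dunit Ldiag; rewrite /curve_length.
under eq_Rintegral.
  move=> t _; rewrite /metric /velocity /geodesic/= !derive1_expm.
  rewrite !mulmxK ?unitmx_mul ?expm_unit//.
  (* The diagonal part of [metric] has no transpose; symmetry of [L] turns it into a Frobenius
     norm. *)
  have -> : L *m L = L *m L^T.
    by rewrite [in L^T](is_diag_mxE Ldiag) tr_diag_mx -is_diag_mxE.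
  rewrite -!sqr_frobenius; over.
by rewrite Rintegral_cst//= lebesgue_measure_itv/= lte01 oppr0 adde0 mulr1.
Qed.

End Length.

Theorem theorem3p14 (R : realType) (p : nat) (k : R)
  (X Y U D V Lam A : 'M[R]_p) :
  0 < k ->
  SymPos X -> SymPos Y ->
  minimal_pair k X Y (U, D) (V, Lam) ->
  is_logSO (V *m U^T) A ->
  minimal_sr_curve k X Y (sr_curve U D A (logDiag (invmx D *m Lam))).
Proof.
move=> k0 _ _ [fX fY [gamma [[]]]].
move=> [U' [D' [A' [L' [_ _ soA' dL' gammaE]]]]] _ _ glen.
rewrite !gammaE /geodesic !scale0r !scale1r !expm0 !mul1mx => -[UE DE] [VE LamE].
move=> logA; have [soA expA Amin] := logA.
have [[SOU Dpos] cX] := fX; have [[SOV Lpos] cY] := fY.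
rewrite /= in SOU SOV Dpos Lpos.
subst U' D'.
set L := logDiag _.
have dL : Diag L by exact: diag_mx_is_diag.
(* The endpoint equation gives [expm L' = invmx D *m Lam], and [logDiag] inverts [expm] on diagonal
   matrices. *)
have L'E : L' = L.
  rewrite /L -LamE (is_diag_mxC (expm_is_diag dL') Dpos.1).
  by rewrite mulKmx ?logDiag_expm ?DiagPos_unit.
have expA' : expm A' = V *m U^T.
  by rewrite -VE -mulmxA SOU.1 mulmx1.
have g1 : geodesic U D A L 1 = (V, Lam).
  rewrite /geodesic !scale1r expA -mulmxA mulmx_SO_V// mulmx1.
  by rewrite expm_logDiag.
have g0 : geodesic U D A L 0 = (U, D).
  by rewrite /geodesic !scale0r !expm0 !mul1mx.
(* The two sides differ only by the order of the commuting factors [D] and [expm (t *: L)]. *)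
have chiE t : sr_curve U D A L t = eigen_comp (geodesic U D A L t).
  rewrite /sr_curve /eigen_comp/geodesic/= trmx_mul -expm_trmx linearZ /=.
  have dE : is_diag_mx (expm (t *: L)).
    apply: expm_is_diag; case/diag_mxP: dL => l ->.
    by rewrite -linearZ diag_mx_is_diag.
  by rewrite (is_diag_mxC dE Dpos.1) !mulmxA.
split.
- by exists U, D, A, L.
- by rewrite chiE g0.
- by rewrite chiE g1.
exists (geodesic U D A L) => //; split.
- by exists U, D, A, L.
- by rewrite g0.
- by rewrite g1.
apply/eqP; rewrite eq_le; apply/andP; split.
- rewrite -glen (_ : gamma = geodesic U D A' L); last first.
    by apply/funext => t; rewrite gammaE L'E.
  rewrite !(curve_length_geodesic _ _ (SO_unit SOU) (DiagPos_unit Dpos) dL).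
  rewrite ler_wsqrtr// lerD2r ler_wpM2l ?divr_ge0 ?(ltW k0)//.
  by rewrite lerXn2r ?nnegrE ?sqrtr_ge0// Amin.
- rewrite (curve_length_geodesic _ _ (SO_unit SOU) (DiagPos_unit Dpos) dL).
  apply: ge_inf.
    (* The infimum is a lower bound because the distances are bounded below by 0. *)
    by exists 0 => _ [P _ [Q _ <-]]; exact: sqrtr_ge0.
  exists (U, D) => //; exists (V, Lam) => //=.
  rewrite /geodesic_dist/=.
  (* [A] witnesses that a logarithm exists, so [logSO] is not its default 0. Both logarithms are
     minimal, hence equal in norm. *)
  have [soB expB Bmin] : is_logSO (V *m U^T) (logSO (V *m U^T)).
    by apply: xgetPex; exists A.
  congr (Num.sqrt (_ * _ ^+ 2 + _ ^+ 2)).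
    by apply/eqP; rewrite eq_le Bmin// Amin.
  (* The distance uses [Lam *m invmx D], while [L] uses the opposite order. *)
  rewrite /L (DiagPos_inv Dpos) (is_diag_mxC Lpos.1)//; exact: diag_mx_is_diag.
Qed.
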